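(* Let $q\ge2$ and $d\ge1$ be integers with $\gcd(2q,d)=1$, let $a=2q$ and $S=\langle 2q,2q+d,2q+2d\rangle$. For $(x_0,x_1,x_2)\in\mathbb{Z}\times\{0,1\}\times\{0,\dots,q-1\}$ put $[x_0,x_1,x_2]=x_0a+x_1(a+d)+x_2(a+2d)$. Then $$\mu_S([x_0,x_1,x_2])=\begin{cases}(-1)^{x_1}\big(\mathfrak{m}_{A_0}-\mathfrak{m}_{A_1}+2\mathfrak{m}_{B_0}-\mathfrak{m}_{B_{-1}}-\mathfrak{m}_{B_1}\big)(x_0) & \text{if } x_2=0,\\ (-1)^{x_1}\big(2\mathfrak{m}_{C_0}-\mathfrak{m}_{C_{-1}}-\mathfrak{m}_{C_1}\big)(x_0-x_2) & \text{if } x_2\ge1.\end{cases}$$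
   Context: $\mu_S$ is the reduced M\''obius function of the poset $(\mathbb{Z},\leq_S)$, where $x\leq_S y$ iff $y-x\in S$: $\mu_S(x)=\mu_S(0,x)$ with $\mu_S(0,0)=1$, $\mu_S(0,y)=-\sum_{z:\,0\leq_S z<_S y}\mu_S(0,z)$ for $0<_S y$, and $\mu_S(0,y)=0$ if $y\notin S$. For a multiset $M$ of integers, $\mathfrak{m}_M:\mathbb{Z}\to\mathbb{N}$ gives the number of times an integer appears in $M$ ($0$ if it does not appear). For $i\in\{-1,0,1\}$ define the multisets $A_i=\{m(q+d)+i: m\in\mathbb{N}\}$, $B_i=\{m(q+d)-nd+i: m\in\mathbb{N}\setminus\{0,1\},\ n\in\{1,\dots,\lfloor m/2\rfloor\}\}$ (with multiplicities counted over all pairs $(m,n)$), and $C_i=A_i\cup B_i$ the multiset union in which multiplicities add, i.e. $\mathfrak{m}_{C_i}=\mathfrak{m}_{A_i}+\mathfrak{m}_{B_i}$. *)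

(* Defs.v *)
From HB Require Import structures.
From mathcomp Require Import all_boot all_order all_algebra finmap zify.
From mathcomp Require Import mathcomp_extra boolp classical_sets functions cardinality fsbigop.

Set Implicit Arguments.
Unset Strict Implicit.
Unset Printing Implicit Defensive.

Import Order.TTheory GRing.Theory Num.Theory.
Local Open Scope classical_set_scope.
Local Open Scope ring_scope.

Definition span3 (a b c : nat) : set int :=
  [set x | exists n0 n1 n2 : nat, x = (n0 * a + n1 * b + n2 * c)%N%:Z].

Definition leS (S : set int) (x y : int) : Prop := S (y - x).

Definition ltS (S : set int) (x y : int) : Prop := leS S x y /\ x <> y.

(* The sum over a classical set is the finite-support sum of fsbigop. The
   first argument is only recursion fuel: when S consists of nonnegative
   integers, the intervals are finite (finite_interval) and the fuel supplied
   in [moebius] always suffices (moebiusE). *)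
Fixpoint moebius_rec (fuel : nat) (S : set int) (x y : int) : int :=
  if fuel is n.+1 then
    if x == y then 1
    else if `[< leS S x y >] then
      - \sum_(z \in [set z | leS S x z /\ ltS S z y]) moebius_rec n S x z
    else 0
  else 0.

Definition moebius (S : set int) (x y : int) : int :=
  moebius_rec `|y - x|%N.+1 S x y.

Definition mu (S : set int) (x : int) : int := moebius S 0 x.

(* The multiplicity of x in the multiset {f i : i in D}. The set of indices is
   finite for the families below (finite_famA, finite_famB); [fset_set] of an
   infinite set would be empty. *)
Definition mult (I : choiceType) (D : set I) (f : I -> int) (x : int) : nat :=
  #|` fset_set [set i | D i /\ f i = x] |.

Definition famA (q d : nat) (i : int) (m : nat) : int :=
  (m * (q + d))%N%:Z + i.

Definition mA (q d : nat) (i : int) : int -> nat :=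
  mult [set: nat] (famA q d i).

Definition famB (q d : nat) (i : int) (p : nat * nat) : int :=
  (p.1 * (q + d))%N%:Z - (p.2 * d)%N%:Z + i.

Definition indB : set (nat * nat) :=
  [set p | (2 <= p.1)%N /\ (1 <= p.2 <= p.1./2)%N].

Definition mB (q d : nat) (i : int) : int -> nat := mult indB (famB q d i).

Definition mC (q d : nat) (i : int) (x : int) : nat :=
  (mA q d i x + mB q d i x)%N.

Definition bracket (q d : nat) (x0 : int) (x1 x2 : nat) : int :=
  x0 * (2 * q)%N%:Z + x1%:Z * (2 * q + d)%N%:Z + x2%:Z * (2 * q + 2 * d)%N%:Z.

Lemma span3_ge0 a b c x : span3 a b c x -> 0 <= x.
Proof. by move=> [n0 [n1 [n2 ->]]]. Qed.

Lemma finite_int_itv (x y : int) : finite_set [set z : int | x <= z <= y].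
Proof.
apply: (@sub_finite_set _ _ ((fun k : nat => x + k%:Z) @` `I_(`|y - x|%N.+1))).
  move=> z /= /andP[xz zy]; exists `|z - x|%N; lia.
exact/finite_image/finite_II.
Qed.

Lemma finite_interval (S : set int) (x y : int) :
  (forall z, S z -> 0 <= z) -> finite_set [set z | leS S x z /\ ltS S z y].
Proof.
move=> S0; apply: sub_finite_set (finite_int_itv x y) => z /=.
by rewrite /ltS /leS => -[/S0 xz [/S0 zy _]]; lia.
Qed.

Lemma moebius_rec_fuel (S : set int) (x : int) : (forall z, S z -> 0 <= z) ->
  forall n y, (`|y - x| < n)%N -> moebius_rec n S x y = moebius S x y.
Proof.
move=> S0.
have H k n m y : (n <= k)%N -> (`|y - x| < n)%N -> (`|y - x| < m)%N ->
    moebius_rec n S x y = moebius_rec m S x y.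
  elim: k n m y => [|k IH] [|n] [|m] y //= nk hn hm.
  case: eqP => // xy; case: asboolP => // Sxy; congr (- _).
  apply: eq_fsbigr => z; rewrite inE /= /ltS /leS => -[/S0 xz [/S0 zy nzy]].
  by apply: IH; lia.
by move=> n y hn; apply: (H n) => //; lia.
Qed.

Lemma moebius_id (S : set int) (x : int) : moebius S x x = 1.
Proof. by rewrite /moebius /= eqxx. Qed.

Lemma moebiusE (S : set int) (x y : int) :
  (forall z, S z -> 0 <= z) -> ltS S x y ->
  moebius S x y = - \sum_(z \in [set z | leS S x z /\ ltS S z y]) moebius S x z.
Proof.
move=> S0 [Sxy /eqP xy]; rewrite {1}/moebius /= (negbTE xy) asboolT //.
congr (- _); apply: eq_fsbigr => z; rewrite inE /= /ltS /leS.
move=> -[/S0 xz [/S0 zy nzy]]; apply: moebius_rec_fuel => //; lia.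
Qed.

Lemma moebius_out (S : set int) (x y : int) :
  S 0 -> ~ leS S x y -> moebius S x y = 0.
Proof.
move=> S0 nxy; rewrite /moebius /=; case: eqP => [xy|_].
  by case: nxy; rewrite xy /leS subrr.
by rewrite asboolF.
Qed.

Lemma finite_famA (q d : nat) (i x : int) : (0 < q)%N ->
  finite_set [set m | [set: nat] m /\ famA q d i m = x].
Proof.
move=> q0; apply: sub_finite_set (finite_II `|x - i|%N.+1) => m /=.
by rewrite /famA => -[_ e]; nia.
Qed.

Lemma finite_famB (q d : nat) (i x : int) : (0 < q)%N ->
  finite_set [set p | indB p /\ famB q d i p = x].
Proof.
move=> q0; set k := `|x - i|%N.+1.
apply: sub_finite_set (finite_setX (finite_II k) (finite_II k)).
move=> [m n] /=; rewrite /indB /famB /= => -[[m2 /andP[n1 nm]] e].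
have hn : (n <= m)%N by lia.
have e1 : (m * q)%N%:Z + ((m - n) * d)%N%:Z = x - i.
  by rewrite -e mulnDr mulnBl; have := leq_mul hn (leqnn d); lia.
have hm : (m <= m * q)%N by rewrite leq_pmulr.
rewrite /k; clear -e1 hm hn.
move: e1; set u := ((m - n) * d)%N; set v := (m * q)%N in hm * => e1.
split=> /=; lia.
Qed.

(* Main.v *)
Require Import Defs.
From mathcomp Require Import all_boot all_order all_algebra.
From mathcomp Require Import finmap zify ring.
From mathcomp Require Import boolp classical_sets cardinality fsbigop.

(** In terms of generating functions, mu_S is the inverse of the indicator of S.
    Since 2(a+d) = a + (a+2d) and q(a+2d) = (q+d)a, every integer is uniquely a
    bracket [x0,x1,x2], which lies in S iff x0 >= 0, and the indicator of S is
    (1-t^(2(a+d)))(1-t^(q(a+2d))) / ((1-t^a)(1-t^(a+d))(1-t^(a+2d))). So mu_S is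
    (1-t^a)(1-t^(a+d))(1-t^(a+2d)) times Phi, the inverse of the numerator. On
    brackets, Phi vanishes for x1 = 1 and equals the multiplicity of x0 - x2 in
    C_0 for x1 = 0; expanding the three factors gives the formula. Multiplication
    by 1 - t^u is the backward difference [bdiff u]. *)

Set Implicit Arguments.
Unset Strict Implicit.
Unset Printing Implicit Defensive.

Import Order.TTheory GRing.Theory Num.Theory.
Local Open Scope classical_set_scope.
Local Open Scope ring_scope.

(** * Backward differences *)

Definition bdiff (u : int) (F : int -> int) (x : int) : int := F x - F (x - u).

Lemma bdiffE u F x : bdiff u F x = F x - F (x - u).
Proof. by []. Qed.

Definition delta0 (x : int) : int := (x == 0)%:Z.

Definition ind (S : set int) (x : int) : int := `[< S x >]%:Z.

Lemma bdiffC u v F : bdiff u (bdiff v F) = bdiff v (bdiff u F).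
Proof.
by apply: funext => x; rewrite /bdiff (addrAC x (- u)); ring.
Qed.

Lemma bdiffB u F G : bdiff u (F \- G) = bdiff u F \- bdiff u G.
Proof. by apply: funext => x; rewrite /bdiff /=; ring. Qed.

Lemma bdiff_neg u F : 0 <= u -> (forall x, x < 0 -> F x = 0) ->
  forall x, x < 0 -> bdiff u F x = 0.
Proof. by move=> u0 F0 x x0; rewrite /bdiff !F0 ?subrr //; lia. Qed.

(** A zero difference makes [F] invariant under subtracting [u], and iterating this reaches the
    negative integers. This is what allows [1 - t^u] to be cancelled. *)
Lemma bdiff_inj0 u F : 0 < u -> (forall x, x < 0 -> F x = 0) ->
  (forall x, bdiff u F x = 0) -> forall x, F x = 0.
Proof.
move=> u0 F0 DF0 x.
have [n] := ubnP `|x|%N; elim: n x => // n IH x xn.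
have [x0|x0] := ltP x 0; first exact: F0.
move/eqP: (DF0 x); rewrite /bdiff subr_eq0 => /eqP ->.
have [x1|x1] := ltP (x - u) 0; first exact: F0.
by apply: IH; lia.
Qed.

(** * The Möbius function as a convolution inverse *)

Lemma mu_lt0 (S : set int) : S 0 -> (forall z, S z -> 0 <= z) ->
  forall x, x < 0 -> mu S x = 0.
Proof.
move=> S0 Sge x x0; apply: moebius_out => //.
by rewrite /leS subr0 => /Sge; lia.
Qed.

(** The defining recursion of [mu], read as a convolution. Cutting the sum at [n > x] loses nothing:
    [ind S (x - k)] vanishes for [k > x], and [mu S] vanishes on negative integers. *)
Lemma mu_conv_ind (S : set int) : S 0 -> (forall x y, S x -> S y -> S (x + y)) ->
  (forall z, S z -> 0 <= z) ->
  forall (n : nat) (x : int), x < n%:Z ->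
  \sum_(k < n) mu S k%:Z * ind S (x - k%:Z) = delta0 x.
Proof.
move=> S0 SD Sge n x xn.
have muS z : mu S z != 0 -> S z.
  by apply: contraNP => Sz; rewrite /mu moebius_out //; rewrite /leS subr0.
have [x0|x0] := ltP x 0.
  rewrite /delta0 lt_eqF // big1 // => k _; rewrite /ind asboolF ?mulr0 //.
  by move=> /Sge; lia.
set P := [set z | leS S 0 z /\ leS S z x].
have -> : \sum_(k < n) mu S k%:Z * ind S (x - k%:Z) = \sum_(z \in P) mu S z.
  rewrite -(big_mkord xpredT (fun k => mu S k%:Z * ind S (x - k%:Z))).
  rewrite -(big_map Posz xpredT (fun z => mu S z * ind S (x - z))).
  rewrite -(@fsbig_fwiden _ _ _ _ _ P) /=.
  - apply: eq_fsbigr => z; rewrite inE /= /leS => -[_ Sz].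
    by rewrite /ind asboolT // mulr1.
  - move=> z [/Sge z0 /Sge zx] /=; apply/mapP; exists `|z|%N; last by lia.
    by rewrite mem_index_iota; lia.
  - by rewrite map_inj_uniq ?iota_uniq // => i j [].
  - move=> z [_ Pz] /=; apply/eqP; rewrite mulf_eq0.
    case: eqVneq => [//|/muS Sz /=].
    rewrite /ind asboolF // => Sxz; apply: Pz; split; last exact: Sxz.
    by rewrite /leS subr0.
have [Sx|Sx] := pselect (S x); last first.
  rewrite /delta0; case: eqP => [x00|_]; first by case: Sx; rewrite x00.
  apply: fsbig1 => z [_ Sxz]; apply: contrapT => /eqP /muS Sz.
  by apply: Sx; rewrite -(subrK z x); apply: SD.
have finP : finite_set P.
  apply: sub_finite_set (finite_int_itv 0 x) => z /=.
  by rewrite /P /leS /= => -[/Sge h1 /Sge h2]; lia.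
rewrite (fsbigD1 x) //=; last by rewrite /P /leS /= subr0 subrr.
have [x00|xN0] := eqVneq x 0.
  rewrite {1 3}x00 /mu moebius_id fsbig1 ?addr0 // => z [] [/Sge h1 /Sge h2] /= h3.
  by case: h3; lia.
(* For nonzero [x] in [S], the term at [x] is minus the sum over the rest of the interval. *)
rewrite {1}/mu moebiusE //; last first.
  by split; [rewrite /leS subr0 | apply/eqP; rewrite eq_sym].
rewrite (_ : P `\ x = [set z | leS S 0 z /\ ltS S z x]) ?addNr.
  by rewrite /delta0 (negbTE xN0).
by apply/seteqP; split => z /=; rewrite /ltS /P /=; tauto.
Qed.

(** Convolution with [mu S] commutes with differences, sends [ind S] to [delta0] and [delta0] to
    [mu S]; it is applied to both sides of the hypothesis. *)
Lemma bdiff_ind_mu (S : set int) (A B C U V : nat) :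
  S 0 -> (forall x y, S x -> S y -> S (x + y)) -> (forall z, S z -> 0 <= z) ->
  bdiff A (bdiff B (bdiff C (ind S))) = bdiff U (bdiff V delta0) ->
  bdiff U (bdiff V (mu S)) = bdiff A (bdiff B (bdiff C delta0)).
Proof.
move=> S0 SD Sge E; apply: funext => x.
(* The differences only look at arguments at most [x], so one truncation bound above [x] serves them
   all. *)
pose n := `|x|%N.+1.
pose conv (F : int -> int) x := \sum_(k < n) mu S k%:Z * F (x - k%:Z).
have convD u F : conv (bdiff u F) = bdiff u (conv F).
  apply: funext => y; rewrite /conv /bdiff -sumrB; apply: eq_bigr => k _.
  by rewrite mulrBr addrAC.
have conv_ind y : y < n%:Z -> conv (ind S) y = delta0 y.
  exact: mu_conv_ind.
have conv_delta y : y < n%:Z -> conv delta0 y = mu S y.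
  move=> yn; rewrite /conv; have [y0|y0] := ltP y 0.
    rewrite mu_lt0 // big1 // => k _; rewrite /delta0.
    by case: eqP => [?|]; rewrite ?mulr0 //; lia.
  have yn' : (`|y| < n)%N by lia.
  rewrite (bigD1 (Ordinal yn')) //= big1 ?addr0 => [|k kN].
    by rewrite /delta0 gez0_abs // subrr mulr1.
  rewrite /delta0; case: eqP => [e|]; rewrite ?mulr0 //.
  by case/eqP: kN; apply: val_inj => /=; lia.
have := congr1 (conv^~ x) E; rewrite !convD /bdiff.
by rewrite !conv_ind ?conv_delta /n; try lia.
Qed.

(** * Brackets as coordinates on the integers *)

(** A bracket equals [(x0 + x1 + x2) * 2q + (x1 + 2 * x2) * d]. Bezout writes [x] as a combination
    of [2q] and [d]; reducing the coefficient of [d] modulo [2q] leaves [r], whose parity and half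
    are [x1] and [x2]. *)
Lemma bracket_exists (q d : nat) (x : int) : (0 < q)%N -> coprime (2 * q) d ->
  exists x0 x1 x2, [/\ (x1 <= 1)%N, (x2 <= q - 1)%N & x = bracket q d x0 x1 x2].
Proof.
move=> q0 cop.
have /coprimezP[[u v] /= uv] : coprimez (2 * q)%N%:Z d%:Z by [].
have q20 : (2 * q)%N%:Z != 0 by lia.
pose k := (x * v %/ (2 * q)%N%:Z)%Z.
pose r := `|(x * v %% (2 * q)%N%:Z)%Z|%N.
have rE : x * v = k * (2 * q)%N%:Z + r%:Z.
  by rewrite {1}(divz_eq (x * v) (2 * q)%N%:Z) /r gez0_abs ?modz_ge0.
have rq : (r < 2 * q)%N.
  have := ltz_mod (x * v) q20; have := modz_ge0 (x * v) q20.
  by rewrite /r; lia.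
have r2 : r = (r %% 2 + 2 * (r %/ 2))%N by lia.
exists (x * u + k * d%:Z - (r %% 2)%N%:Z - (r %/ 2)%N%:Z), (r %% 2)%N, (r %/ 2)%N.
split; [lia|lia|].
move: rE; rewrite /bracket {1}r2; move: (r %% 2)%N (r %/ 2)%N => x1 x2 rE.
rewrite -[LHS]mulr1 -uv mulrDr !mulrA rE.
by rewrite !(PoszD, PoszM); ring.
Qed.

Lemma bracket_inj (q d : nat) (x0 y0 : int) (x1 x2 y1 y2 : nat) :
  (0 < q)%N -> coprime (2 * q) d ->
  (x1 <= 1)%N -> (x2 <= q - 1)%N -> (y1 <= 1)%N -> (y2 <= q - 1)%N ->
  bracket q d x0 x1 x2 = bracket q d y0 y1 y2 -> [/\ x0 = y0, x1 = y1 & x2 = y2].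
Proof.
move=> q0 cop hx1 hx2 hy1 hy2; rewrite /bracket => e.
have /dvdzP [k ek] : ((2 * q)%N%:Z %| (x1 + 2 * x2)%N%:Z - (y1 + 2 * y2)%N%:Z)%Z.
  rewrite -(@Gauss_dvdzl _ _ d%:Z) //.
  apply/dvdzP; exists (y0 - x0 + y1%:Z - x1%:Z + y2%:Z - x2%:Z).
  apply/eqP; rewrite -subr_eq0; move/eqP: e; rewrite -subr_eq0 => /eqP e.
  by apply/eqP; rewrite -[RHS]e !(PoszD, PoszM); ring.
(* Both [x1 + 2 * x2] and [y1 + 2 * y2] lie between [0] and [2q - 1]. *)
have k0 : k = 0 by nia.
move: ek; rewrite k0 mul0r => ek.
have e1 : x1 = y1 by lia.
have e2 : x2 = y2 by lia.
split=> //; move: e; rewrite e1 e2 => /addIr /addIr /mulIf; apply; lia.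
Qed.

Lemma bracket_shifta q d x0 x1 x2 :
  bracket q d x0 x1 x2 - (2 * q)%N%:Z = bracket q d (x0 - 1) x1 x2.
Proof. by rewrite /bracket; ring. Qed.

Lemma bracket_shiftb q d x0 x2 :
  bracket q d x0 1 x2 - (2 * q + d)%N%:Z = bracket q d x0 0 x2.
Proof. by rewrite /bracket; ring. Qed.

Lemma bracket_shiftc q d x0 x1 x2 :
  bracket q d x0 x1 x2.+1 - (2 * q + 2 * d)%N%:Z = bracket q d x0 x1 x2.
Proof. by rewrite /bracket -addn1 PoszD; ring. Qed.

(** A borrow: as [q(a+2d) = (q+d)a], raising [x2] by [q] costs [q + d] in [x0]. *)
Lemma bracket_shiftc0 q d x0 x1 : (0 < q)%N ->
  bracket q d x0 x1 0 - (2 * q + 2 * d)%N%:Z =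
  bracket q d (x0 - (q + d)%N%:Z) x1 (q - 1).
Proof.
by case: q => // q _; rewrite /bracket subn1 -addn1 !(PoszD, PoszM) /=; ring.
Qed.

Lemma bracket_shiftqc q d x0 x1 x2 :
  bracket q d x0 x1 x2 - (q * (2 * q + 2 * d))%N%:Z =
  bracket q d (x0 - (q + d)%N%:Z) x1 x2.
Proof. by rewrite /bracket !(PoszD, PoszM); ring. Qed.

Lemma bracket_shift2b q d x0 x1 x2 :
  bracket q d x0 x1 x2.+1 - (2 * (2 * q + d))%N%:Z = bracket q d (x0 - 1) x1 x2.
Proof. by rewrite /bracket -addn1 !(PoszD, PoszM); ring. Qed.

Lemma bracket_shift2b0 q d x0 x1 : (0 < q)%N ->
  bracket q d x0 x1 0 - (2 * (2 * q + d))%N%:Z =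
  bracket q d (x0 - (q + d)%N%:Z - 1) x1 (q - 1).
Proof.
by case: q => // q _; rewrite /bracket subn1 -addn1 !(PoszD, PoszM) /=; ring.
Qed.

(** From [2(a+d) = a + (a+2d)]: removing [a+d] when [x1 = 0] trades one [a] and one [a+2d] for one
    [a+d]. *)
Lemma bracket_shiftbS q d x0 x2 :
  bracket q d x0 0 x2.+1 - (2 * q + d)%N%:Z = bracket q d (x0 - 1) 1 x2.
Proof. by rewrite /bracket -addn1 !(PoszD, PoszM); ring. Qed.

Lemma bracket_shiftb0 q d x0 : (0 < q)%N ->
  bracket q d x0 0 0 - (2 * q + d)%N%:Z =
  bracket q d (x0 - (q + d)%N%:Z - 1) 1 (q - 1).
Proof.
by case: q => // q _; rewrite /bracket subn1 -addn1 !(PoszD, PoszM) /=; ring.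
Qed.

(** * The semigroup and its generating function *)

Lemma span3_0 a b c : span3 a b c 0.
Proof. by exists 0%N, 0%N, 0%N; rewrite !mul0n. Qed.

Lemma span3D a b c x y : span3 a b c x -> span3 a b c y -> span3 a b c (x + y).
Proof.
move=> [m0 [m1 [m2 ->]]] [n0 [n1 [n2 ->]]].
by exists (m0 + n0)%N, (m1 + n1)%N, (m2 + n2)%N; rewrite -PoszD; congr Posz; ring.
Qed.

(** Any combination of generators is normalized by trading pairs of [a+d] for [a] and [a+2d], then
    [q] copies of [a+2d] for [q+d] copies of [a]. Both trades only increase the coefficient of
    [a]. *)
Lemma span3_bracket (q d : nat) (x0 : int) (x1 x2 : nat) :
  (0 < q)%N -> coprime (2 * q) d -> (x1 <= 1)%N -> (x2 <= q - 1)%N ->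
  span3 (2 * q) (2 * q + d) (2 * q + 2 * d) (bracket q d x0 x1 x2) <-> 0 <= x0.
Proof.
move=> q0 cop hx1 hx2; split=> [[n0 [n1 [n2 e]]]|x00]; last first.
  exists `|x0|%N, x1, x2; rewrite /bracket -{1}(gez0_abs x00).
  by rewrite !(PoszD, PoszM).
set m2 := (n1 %/ 2 + n2)%N.
have : bracket q d x0 x1 x2 =
    bracket q d (n0 + n1 %/ 2 + (m2 %/ q) * (q + d))%N (n1 %% 2) (m2 %% q).
  rewrite e {1}(divn_eq n1 2) /bracket.
  have n2E : n2%:Z = (m2 %/ q)%N%:Z * q%:Z + (m2 %% q)%N%:Z - (n1 %/ 2)%N%:Z.
    by rewrite -PoszM -PoszD -divn_eq /m2; lia.
  by rewrite !(PoszD, PoszM) n2E; ring.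
have m2q : (m2 %% q <= q - 1)%N by rewrite subn1 -ltnS prednK ?ltn_pmod.
by case/bracket_inj=> // [|-> _ _]; first lia.
Qed.

Lemma ind_bracket (q d : nat) (x0 : int) (x1 x2 : nat) :
  (0 < q)%N -> coprime (2 * q) d -> (x1 <= 1)%N -> (x2 <= q - 1)%N ->
  ind (span3 (2 * q) (2 * q + d) (2 * q + 2 * d)) (bracket q d x0 x1 x2) =
  ((0 <= x0)%R : nat)%:Z.
Proof.
move=> q0 cop hx1 hx2; rewrite /ind; congr Posz; congr nat_of_bool.
by apply/asboolP/idP => /span3_bracket; apply.
Qed.

Lemma delta0_bracket (q d : nat) (x0 : int) (x1 x2 : nat) :
  (0 < q)%N -> coprime (2 * q) d -> (x1 <= 1)%N -> (x2 <= q - 1)%N ->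
  delta0 (bracket q d x0 x1 x2) = [&& x0 == 0, x1 == 0%N & x2 == 0%N]%:Z.
Proof.
move=> q0 cop hx1 hx2; rewrite /delta0; congr Posz; congr nat_of_bool.
apply/eqP/and3P => [e|[/eqP-> /eqP-> /eqP->]]; last by rewrite /bracket !mul0r.
have e0 : bracket q d x0 x1 x2 = bracket q d 0 0 0 by rewrite e /bracket !mul0r.
by have [-> -> ->] := bracket_inj q0 cop hx1 hx2 (leq0n 1) (leq0n (q - 1)) e0.
Qed.

Lemma bdiff_ind_span3 (q d : nat) : (2 <= q)%N -> coprime (2 * q) d ->
  bdiff (2 * q)%N (bdiff (2 * q + d)%N (bdiff (2 * q + 2 * d)%N
    (ind (span3 (2 * q) (2 * q + d) (2 * q + 2 * d))))) =
  bdiff (2 * (2 * q + d))%N (bdiff (q * (2 * q + 2 * d))%N delta0).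
Proof.
move=> q2 cop; have q0 : (0 < q)%N by lia.
set S := span3 _ _ _.
(* Differencing by [a+2d] cancels except at [x2 = 0], where the borrow leaves the window [I]; [K] is
   the difference of [I] by 1. *)
pose I (x0 : int) : int := ((0 <= x0 < (q + d)%N%:Z)%R : nat)%:Z.
pose K (x0 : int) : int := (x0 == 0)%:Z - (x0 == (q + d)%N%:Z)%:Z.
have DcE x0 x1 x2 : (x1 <= 1)%N -> (x2 <= q - 1)%N ->
    bdiff (2 * q + 2 * d)%N (ind S) (bracket q d x0 x1 x2) =
    if x2 == 0%N then I x0 else 0.
  move=> hx1; case: x2 => [|x2] hx2; rewrite /bdiff.
    by rewrite bracket_shiftc0 // !ind_bracket //= /I; lia.
  by rewrite bracket_shiftc !ind_bracket //=; lia.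
have DbcE x0 x1 x2 : (x1 <= 1)%N -> (x2 <= q - 1)%N ->
    bdiff (2 * q + d)%N (bdiff (2 * q + 2 * d)%N (ind S)) (bracket q d x0 x1 x2) =
    if x1 == 1%N then 0 else if x2 == 0%N then I x0
    else if x2 == 1%N then - I (x0 - 1) else 0.
  case: x1 => [_|[_|//]] hx2; rewrite bdiffE.
    case: x2 hx2 => [|x2] hx2.
      (* The borrow lands at [x2 = q - 1], which is nonzero because [q >= 2]. *)
      by rewrite bracket_shiftb0 // !DcE //= ifF ?subr0 //; lia.
    rewrite bracket_shiftbS !DcE //=; last by lia.
    by case: x2 hx2 => [|x2] hx2 //=; rewrite sub0r ?oppr0.
  by rewrite bracket_shiftb !DcE //= subrr.
have IK x0 : I x0 - I (x0 - 1) = K x0 by rewrite /I /K; lia.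
have DqcE x0 x1 x2 : (x1 <= 1)%N -> (x2 <= q - 1)%N ->
    bdiff (q * (2 * q + 2 * d))%N delta0 (bracket q d x0 x1 x2) =
    if (x1 == 0%N) && (x2 == 0%N) then K x0 else 0.
  move=> hx1 hx2; rewrite /bdiff bracket_shiftqc !delta0_bracket // /K.
  by case: (x1 == _); case: (x2 == _); rewrite /= ?andbT ?andbF ?subr_eq0 ?subr0.
apply: funext => x.
have [x0 [x1 [x2 [hx1 hx2 ->]]]] := bracket_exists x q0 cop.
rewrite [LHS]bdiffE bracket_shifta !DbcE //.
rewrite [RHS]bdiffE.
case: x2 hx2 => [|x2] hx2.
  have qN1 : (q - 1 == 0)%N = false by lia.
  rewrite bracket_shift2b0 // !DqcE //= andbT qN1 andbF subr0.
  by case: x1 hx1 => [|[|]] //= _; rewrite IK.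
rewrite bracket_shift2b !DqcE //=; try lia.
by case: x1 hx1 => [|[|]] //= _; case: x2 hx2 => [|x2] hx2 //=; rewrite -?IK; lia.
Qed.

(** * Recursions for the multiplicities *)

Lemma card_fset_setU_image (I J : choiceType) (h : J -> I) (A : set I) (B : set J) :
  injective h -> finite_set A -> finite_set B -> A `&` (h @` B) `<=` set0 ->
  #|` fset_set (A `|` h @` B)| = (#|` fset_set A| + #|` fset_set B|)%N.
Proof.
move=> h_inj fA fB AB0; rewrite fset_setU //; last exact: finite_image.
rewrite cardfsU -fset_setI //; last exact: finite_image.
move: AB0; rewrite subset0 => ->; rewrite fset_set0 cardfs0 subn0.
by rewrite fset_set_image // card_imfset.
Qed.

Lemma mA_shift q d i x : mA q d i x = mA q d 0 (x - i).
Proof.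
rewrite /mA /mult; congr #|` fset_set _|.
by apply/seteqP; split => m /=; rewrite /famA => -[_ ?]; split=> //; lia.
Qed.

Lemma mB_shift q d i x : mB q d i x = mB q d 0 (x - i).
Proof.
rewrite /mB /mult; congr #|` fset_set _|.
by apply/seteqP; split => m /=; rewrite /famB => -[? ?]; split=> //; lia.
Qed.

Lemma mC_shift q d i x : mC q d i x = mC q d 0 (x - i).
Proof. by rewrite /mC mA_shift mB_shift. Qed.

(** The index [m = 0] accounts for the first summand; the other indices are successors. *)
Lemma mA_rec q d x : (0 < q)%N ->
  mA q d 0 x = ((x == 0) + mA q d 0 (x - (q + d)%N%:Z))%N.
Proof.
move=> q0; rewrite [in RHS]/mA /mult.
have -> : (x == 0 : nat) = #|` fset_set [set m : nat | m = 0%N /\ x = 0]|.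
  have [->|x0] := eqVneq x 0.
    rewrite (_ : [set m | _] = [set 0%N]) ?fset_set1 ?cardfs1 //.
    by apply/seteqP; split => m /=; [case|].
  rewrite (_ : [set m | _] = set0) ?fset_set0 ?cardfs0 //.
  by apply/seteqP; split => m //= -[_ /eqP]; rewrite (negbTE x0).
rewrite -(@card_fset_setU_image _ _ S).
- rewrite /mA /mult; congr #|` fset_set _|.
  apply/seteqP; split => [[|m]|m] /=.
  + by rewrite /famA mul0n => -[_ <-]; left.
  + rewrite /famA mulSn PoszD => -[_ e]; right; exists m => //; split=> //.
    by rewrite -e; ring.
  + case=> [[-> ->]|[k [_ e] <-]]; split=> //; rewrite /famA ?mul0n //.
    by move: e; rewrite /famA mulSn PoszD; lia.
- exact: succn_inj.
- by apply: sub_finite_set (finite_set1 0%N) => m [].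
- exact: finite_famA.
- by move=> m [/= [-> _]] [k _].
Qed.

(* (m, n) |-> (m - 2, n - 1) maps the index set of B_0 onto the pairs with
   0 <= n <= m/2, those with n = 0 being the index set of A_0. *)
Lemma mB_rec q d x : (0 < q)%N ->
  mB q d 0 x = mC q d 0 (x - (2 * q + d)%N%:Z).
Proof.
move=> q0; rewrite /mC /mA /mB /mult.
set y := x - _.
pose T := [set p : nat * nat | (p.2 <= p.1./2)%N /\ famB q d 0 p = y].
pose A0 := [set m : nat | [set: nat] m /\ famA q d 0 m = y].
pose B0 := [set p : nat * nat | indB p /\ famB q d 0 p = y].
have TE : T = B0 `|` (fun m => (m, 0%N)) @` A0.
  apply/seteqP; split=> [[m [|n]]|[m n]] /=.
  - rewrite /T /famB /= mul0n subr0 => -[_ e]; right; exists m => //.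
  - rewrite /T /= => -[nm e]; left; split=> //; rewrite /indB /=; lia.
  - case=> [[+ e]|[k [_ e] [<- <-]]].
      by rewrite /indB /= => h; split=> //=; lia.
    by rewrite /T /famB /= mul0n subr0; split.
have fA : finite_set A0 by exact: finite_famA.
have fB : finite_set B0 by exact: finite_famB.
(* The empty first member lets the counting lemma for unions handle a bare image. The reindexing
   shifts values by [2(q+d) - d = 2q + d]. *)
have -> : [set p | indB p /\ famB q d 0 p = x] =
    set0 `|` (fun p : nat * nat => (p.1.+2, p.2.+1)) @` T.
  rewrite set0U; apply/seteqP; split => [[m n] /= [+ e]|p /=].
    rewrite /indB /= => h; exists (m - 2, n - 1)%N; last first.
      by move: h => /= h; congr pair; lia.
    split=> /=; first by lia.
    move: e; rewrite /famB /y /= => <-.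
    have -> : m = (m - 2).+2 by lia.
    have {2}-> : n = (n - 1).+1 by lia.
    by rewrite !subSS !subn0 !mulSn !(PoszD, PoszM); ring.
  move=> [[m n] [/= nm e] <-]; split; first by rewrite /indB /=; lia.
  have -> : x = y + (2 * q + d)%N%:Z by rewrite /y subrK.
  by rewrite -e /famB /= !mulSn !(PoszD, PoszM); ring.
have fT : finite_set T.
  by rewrite TE finite_setU; split=> //; apply: finite_image.
rewrite card_fset_setU_image //.
- rewrite fset_set0 cardfs0 add0n TE card_fset_setU_image // 1?addnC //.
  + by move=> m n [].
  + by move=> p [[+ _] [k _ e]]; rewrite /indB -e /=; lia.
- by move=> [m n] [m' n'] /= [-> ->].
Qed.

Lemma mC_lt0 q d x : x < 0 -> mC q d 0 x = 0%N.
Proof.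
move=> x0; rewrite /mC /mA /mB /mult.
rewrite (_ : [set m | _] = set0); last first.
  by apply/seteqP; split => m //= [_]; rewrite /famA; lia.
rewrite (_ : [set p | _] = set0) ?fset_set0 ?cardfs0 //.
apply/seteqP; split => -[m n] //= [+ e]; rewrite /indB /= => h.
have : (n * d <= m * (q + d))%N by apply: leq_mul; lia.
by move: e; rewrite /famB /=; lia.
Qed.

(** * The inverse of the numerator, and the formula *)

(** Coordinates exist and are unique, so a function of an integer may be prescribed on brackets;
    choice selects the coordinates. *)
Lemma bracket_lift (q d : nat) (g : int -> nat -> nat -> int) :
  (0 < q)%N -> coprime (2 * q) d ->
  exists F : int -> int, forall x0 x1 x2, (x1 <= 1)%N -> (x2 <= q - 1)%N ->
    F (bracket q d x0 x1 x2) = g x0 x1 x2.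
Proof.
move=> q0 cop.
have ex x : exists p : int * nat * nat, [/\ (p.1.2 <= 1)%N, (p.2 <= q - 1)%N
    & x = bracket q d p.1.1 p.1.2 p.2].
  by have [x0 [x1 [x2 h]]] := bracket_exists x q0 cop; exists (x0, x1, x2).
have [nf nfP] := choice ex.
exists (fun x => g (nf x).1.1 (nf x).1.2 (nf x).2) => x0 x1 x2 hx1 hx2.
have [h1 h2 e] := nfP (bracket q d x0 x1 x2).
by have [<- <- <-] := bracket_inj q0 cop hx1 hx2 h1 h2 e.
Qed.

Theorem theorem6p1 (q d : nat) (x0 : int) (x1 x2 : nat)
  (hq : (2 <= q)%N) (hd : (1 <= d)%N) (hqd : coprime (2 * q) d)
  (hx1 : (x1 <= 1)%N) (hx2 : (x2 <= q - 1)%N) :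
  mu (span3 (2 * q) (2 * q + d) (2 * q + 2 * d)) (bracket q d x0 x1 x2) =
  if x2 == 0%N then
    (-1) ^+ x1 *
      ((mA q d 0 x0)%:Z - (mA q d 1 x0)%:Z + 2 * (mB q d 0 x0)%:Z
       - (mB q d (-1) x0)%:Z - (mB q d 1 x0)%:Z)
  else
    (-1) ^+ x1 *
      (2 * (mC q d 0 (x0 - x2%:Z))%:Z - (mC q d (-1) (x0 - x2%:Z))%:Z
       - (mC q d 1 (x0 - x2%:Z))%:Z).
Proof.
have q0 : (0 < q)%N by lia.
set S := span3 _ _ _.
pose phi (y : int) : int := mC q d 0 y.
have [Phi PhiE] := bracket_lift
  (fun y0 y1 y2 => if y1 == 0%N then phi (y0 - y2%:Z) else 0) q0 hqd.
have phiE y : phi y = (mA q d 0 y)%:Z + phi (y - (2 * q + d)%N%:Z).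
  by rewrite {1}/phi /mC PoszD mB_rec.
(* The two recursions say that [phi] has generating function [1 / ((1 - s^(q+d))(1 - s^(2q+d)))];
   [K] removes the first factor. *)
pose K (y : int) : int := phi y - phi (y - (q + d)%N%:Z).
have KE y : K y = (y == 0)%:Z + K (y - (2 * q + d)%N%:Z).
  rewrite /K (phiE y) (phiE (y - (q + d)%N%:Z)) (mA_rec d y q0) PoszD.
  by rewrite (addrAC y (- _%:Z)); ring.
have DqcPhi y0 y1 y2 : (y1 <= 1)%N -> (y2 <= q - 1)%N ->
    bdiff (q * (2 * q + 2 * d))%N Phi (bracket q d y0 y1 y2) =
    if y1 == 0%N then K (y0 - y2%:Z) else 0.
  move=> hy1 hy2; rewrite bdiffE bracket_shiftqc !PhiE // addrAC /K.
  by case: ifP.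
have DPhi : bdiff (2 * (2 * q + d))%N (bdiff (q * (2 * q + 2 * d))%N Phi) = delta0.
  apply: funext => y.
  have [y0 [y1 [y2 [hy1 hy2 ->]]]] := bracket_exists y q0 hqd.
  rewrite delta0_bracket // bdiffE; case: y2 hy2 => [|y2] hy2.
    rewrite bracket_shift2b0 // !DqcPhi //.
    (* The borrow lowers [y0 - y2] by [(q+d) + 1 + (q-1) = 2q + d], exactly the step in [KE]. *)
    rewrite subr0 (_ : _ - 1 - _ = y0 - (2 * q + d)%N%:Z); last by lia.
    by case: (y1 == 0%N); rewrite ?andbF ?andbT ?subrr // KE addrK.
  rewrite bracket_shift2b !DqcPhi //; last by lia.
  by rewrite (_ : y0 - 1 - y2%:Z = y0 - y2.+1%:Z) ?subrr ?andbF //; lia.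
have Phi_lt0 y : y < 0 -> Phi y = 0.
  have [y0 [y1 [y2 [hy1 hy2 ->]]]] := bracket_exists y q0 hqd.
  move=> yneg; rewrite PhiE //; case: ifP => // _; rewrite /phi mC_lt0 //.
  by move: yneg; rewrite /bracket; nia.
have Sge : forall z, S z -> 0 <= z by move=> z; apply: span3_ge0.
have S0 : S 0 by exact: span3_0.
have SD : forall x y, S x -> S y -> S (x + y) by move=> x y; apply: span3D.
(* Both sides vanish on negative integers and agree after the two numerator differences, so
   [bdiff_inj0] identifies them. *)
have muE : mu S = bdiff (2 * q)%N (bdiff (2 * q + d)%N (bdiff (2 * q + 2 * d)%N Phi)).
  set G := RHS.
  have G_lt0 : forall y, y < 0 -> G y = 0 by do 3!apply: bdiff_neg => //.
  have muG_lt0 y : y < 0 -> (mu S \- G) y = 0.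
    by move=> yneg; rewrite /= mu_lt0 // G_lt0.
  suff H y : (mu S \- G) y = 0.
    by apply: funext => y; apply/eqP; rewrite -subr_eq0; apply/eqP/H.
  move: y; apply: (@bdiff_inj0 (q * (2 * q + 2 * d))%N) => //; first by nia.
  apply: (@bdiff_inj0 (2 * (2 * q + d))%N); first by lia.
    by apply: bdiff_neg.
  have Emu := bdiff_ind_mu S0 SD Sge (bdiff_ind_span3 hq hqd).
  have EG : bdiff (2 * (2 * q + d))%N (bdiff (q * (2 * q + 2 * d))%N G) =
      bdiff (2 * q)%N (bdiff (2 * q + d)%N (bdiff (2 * q + 2 * d)%N delta0)).
    rewrite -DPhi /G 3!(bdiffC (q * (2 * q + 2 * d))%N).
    by rewrite 3!(bdiffC (2 * (2 * q + d))%N).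
  by move=> y; rewrite (bdiffB _ (mu S) G) bdiffB Emu EG /= subrr.
(* [Phi] lives on [x1 = 0], and subtracting [a+d] flips [x1], so one of the two terms vanishes: this
   is the source of the sign. *)
have DbPhi y0 y1 y2 : (y1 <= 1)%N -> (y2 <= q - 1)%N ->
    bdiff (2 * q + d)%N Phi (bracket q d y0 y1 y2) = (-1) ^+ y1 * phi (y0 - y2%:Z).
  case: y1 => [_|[_|//]] hy2; rewrite bdiffE PhiE //=.
    rewrite mul1r; case: y2 hy2 => [|y2] hy2.
      by rewrite bracket_shiftb0 // PhiE //= subr0.
    by rewrite bracket_shiftbS PhiE //= ?subr0 //; lia.
  by rewrite bracket_shiftb PhiE //= sub0r mulN1r.
rewrite muE (bdiffC (2 * q + d)%N) bdiffE bracket_shifta !(bdiffE (2 * q + 2 * d)%N).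
have mBE y : (mB q d 0 y)%:Z = phi (y - (2 * q + d)%N%:Z) by rewrite mB_rec.
case: x2 hx2 => [|x2] hx2 /=.
  rewrite !bracket_shiftc0 // !DbPhi // !subr0.
  rewrite (mA_shift q d 1) (mB_shift q d 1) (mB_shift q d (-1)).
  (* The borrow to [x2 = q - 1] shifts by [(q+d) + (q-1)], one less than [2q + d]; by [mBE] these
     terms become values of [mB] instead of [mC]. *)
  rewrite (_ : x0 - (q + d)%N%:Z - _ = x0 - -1 - (2 * q + d)%N%:Z); last by lia.
  rewrite (_ : x0 - 1 - (q + d)%N%:Z - _ = x0 - (2 * q + d)%N%:Z); last by lia.
  by rewrite -!mBE /phi /mC !PoszD; ring.
rewrite !bracket_shiftc !DbPhi //; try lia.
rewrite (mC_shift q d 1) (mC_shift q d (-1)) -/(phi _).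
(* For positive [x2] no borrow occurs, and the differences by [a] and [a+2d] form a second
   difference of [phi], up to sign. *)
rewrite (_ : x0 - x2.+1%:Z - -1 = x0 - x2%:Z); last by lia.
rewrite (_ : x0 - x2.+1%:Z - 1 = x0 - 1 - x2.+1%:Z); last by lia.
rewrite (_ : x0 - 1 - x2%:Z = x0 - x2.+1%:Z); last by lia.
by rewrite /phi; ring.
Qed.
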